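(* Let $H=(V,E)$ be a finite hypergraph in which every vertex has degree at most 1 (i.e., the edges are non-empty, pairwise disjoint subsets of $V$; edges of size 1 are allowed). (i) If every vertex of $H$ has degree exactly 1, then $H$ is $\mathbb{Z}_2\times\mathbb{Z}_2$-cordial if and only if at least one of $|V|$, $|E|$ is odd, or both are even and $|V|\equiv |E|\pmod 4$. (ii) If $H$ has at least one vertex of degree 0, then $H$ is $\mathbb{Z}_2\times\mathbb{Z}_2$-cordial.
   Context: The degree of a vertex is the number of edges containing it. Let $A=\mathbb{Z}_2\times\mathbb{Z}_2$. For a hypergraph $H=(V,E)$ and a labeling $c:V\to A$, write $v_c(a)=|c^{-1}(a)|$; $c$ is $A$-friendly if $|v_c(a)-v_c(b)|\le 1$ for all $a,b\in A$. It induces $c^*:E\to A$, $c^*(e)=\sum_{v\in e}c(v)$; write $e_{c^*}(a)=|(c^* )^{-1}(a)|$. $H$ is $A$-cordial if it admits an $A$-friendly labeling $c$ with $|e_{c^*}(a)-e_{c^*}(b)|\le 1$ for all $a,b\in A$. *)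

(* Defs.v *)
From HB Require Import structures.
From mathcomp Require Import all_boot all_order all_algebra.
Set Implicit Arguments. Unset Strict Implicit. Unset Printing Implicit Defensive.
Import GRing.Theory.

Definition A := ('Z_2 * 'Z_2)%type.

Definition degree (V : finType) (E : {set {set V}}) (v : V) : nat :=
  #|[set e in E | v \in e]|.

Definition vcount (V : finType) (c : V -> A) (a : A) : nat :=
  #|[set v : V | c v == a]|.

Definition induced (V : finType) (c : V -> A) (e : {set V}) : A :=
  (\sum_(v in e) c v)%R.

Definition ecount (V : finType) (E : {set {set V}}) (c : V -> A) (a : A) : nat :=
  #|[set e in E | induced c e == a]|.

Definition close (x y : nat) : Prop := (x <= y + 1)%N /\ (y <= x + 1)%N.

Definition friendly (V : finType) (c : V -> A) : Prop :=
  forall a b : A, close (vcount c a) (vcount c b).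

Definition cordial (V : finType) (E : {set {set V}}) : Prop :=
  exists c : V -> A, friendly c /\
    forall a b : A, close (ecount E c a) (ecount E c b).

(* Main.v *)
(** Only the sizes of the edges and the number of isolated vertices matter, since
    the edges are disjoint. A block of four vertices carrying each label once has
    sum 0, so it can be added to any edge: an edge size may be lowered by 4 while
    it exceeds 4. Four edges of the same size k <= 4 can be labelled so that each
    label occurs k times and each sum occurs once, so they can be removed as well.
    Both steps preserve |V| and |E| mod 4, and leave 256 cases (at most three edges
    of each size 1, 2, 3, 4), which a backtracking search settles; one isolated
    vertex is used exactly when |V| and |E| are even and distinct mod 4. Any further
    isolated vertex takes a least frequent label. Conversely, an evenly distributed
    family of even length sums to 0 exactly when its length is divisible by 4; the
    vertex labels and the edge sums have the same total when no vertex is isolated. *)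
Require Import Defs.
From HB Require Import structures.
From mathcomp Require Import all_boot all_order all_algebra.
From mathcomp Require Import zify ring.
Import GRing.Theory.

(** * Fair sequences of labels and their sums *)

Definition labels : seq A := [:: (0, 0); (0, 1); (1, 0); (1, 1)]%R.

Definition total (s : seq A) : A := foldr +%R 0%R s.

Definition fair (s : seq A) : Prop :=
  forall a b, close (count_mem a s) (count_mem b s).

Lemma labelsP (a : A) : a \in labels.
Proof. by case: a => [[[|[|i]] //= Hi] [[|[|j]] //= Hj]]. Qed.

Lemma count_labels (a : A) : count_mem a labels = 1.
Proof. by rewrite count_uniq_mem // labelsP. Qed.

Lemma count_labels_cat (a : A) (s : seq A) :
  count_mem a (labels ++ s) = (count_mem a s).+1.
Proof. by rewrite count_cat count_labels. Qed.

Lemma totalE (s : seq A) : total s = (\sum_(x <- s) x)%R.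
Proof. by rewrite /total foldrE. Qed.

Lemma total_cat (s t : seq A) : total (s ++ t) = (total s + total t)%R.
Proof. by rewrite !totalE big_cat. Qed.

Lemma fair_perm {s t : seq A} : perm_eq s t -> fair s -> fair t.
Proof. by move=> /permP st fs a b; rewrite -!st. Qed.

Lemma fair_uniq (s : seq A) : uniq s -> fair s.
Proof.
by move=> us a b; rewrite !count_uniq_mem //; split; case: (_ \in _); case: (_ \in _).
Qed.

Lemma fair_copies_cat (k : nat) (s : seq A) :
  fair s -> fair (flatten (nseq k labels) ++ s).
Proof.
move=> fs; elim: k => [//|k IH] a b.
rewrite -[flatten _]/(labels ++ flatten (nseq k labels)) -catA !count_labels_cat.
by case: (IH a b) => h1 h2; split; rewrite addSn ltnS.
Qed.

(** Close counts are a common [m] plus a bit each. As the total is even, both parity conditions say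
    that all four counts have the same parity, so that the bits agree and add up to 0 or 4;
    otherwise exactly two bits are set. *)
Lemma close_four_parity (p q u v : nat) :
  close p q -> close p u -> close p v -> close q u -> close q v -> close u v ->
  ~~ odd (p + q + u + v) ->
  (~~ odd (u + v) && ~~ odd (q + v)) = (4 %| p + q + u + v).
Proof.
move=> [? ?] [? ?] [? ?] [? ?] [? ?] [? ?] ev.
pose m := minn (minn p q) (minn u v).
have [p' hp] : exists p' : bool, p = m + p' by exists (m < p); rewrite /m; lia.
have [q' hq] : exists p' : bool, q = m + p' by exists (m < q); rewrite /m; lia.
have [u' hu] : exists p' : bool, u = m + p' by exists (m < u); rewrite /m; lia.
have [v' hv] : exists p' : bool, v = m + p' by exists (m < v); rewrite /m; lia.
rewrite {}hp {}hq {}hu {}hv in ev *.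
move: m ev.
by case: p' q' u' v' => [] [] [] [] m; lia.
Qed.

(** The two coordinates of the sum are the parities of [n (1, 0) + n (1, 1)] and
    [n (0, 1) + n (1, 1)], which reduces the claim to the four counts. *)
Lemma sum_fair_eq0 (s : seq A) :
  fair s -> ~~ odd (size s) -> ((\sum_(x <- s) x)%R == 0%R :> A) = (4 %| size s).
Proof.
move=> fs ev.
pose n a := count_mem a s.
have sumE : (\sum_(x <- s) x =
    ((n (1, 0) + n (1, 1))%:R, (n (0, 1) + n (1, 1))%:R) :> A)%R.
  rewrite /n {fs ev n}; elim: s => [|x s IH]; first by rewrite big_nil.
  rewrite big_cons IH /=; have := labelsP x; rewrite !inE.
  by case/or4P => /eqP -> /=; apply/eqP; rewrite xpair_eqE; apply/andP; split; apply/eqP => /=; ring.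
have sizeE : size s = n (0, 0)%R + n (0, 1)%R + n (1, 0)%R + n (1, 1)%R.
  rewrite /n {fs ev n sumE}; elim: s => //= x s ->; have := labelsP x; rewrite !inE.
  by case/or4P => /eqP -> /=; lia.
have F2 (k : nat) : ((k%:R : 'Z_2) == 0)%R = ~~ odd k.
  by rewrite -val_eqE /= Zp_nat /= modn2 eqb0.
rewrite sumE xpair_eqE !F2; rewrite sizeE in ev *.
exact: close_four_parity (fs _ _) (fs _ _) (fs _ _) (fs _ _) (fs _ _) (fs _ _) ev.
Qed.

(** * Cordiality in terms of edge sizes *)

(** Cordiality for edges of sizes [ks] and [r] isolated vertices: [ls] holds the labels edge by
    edge, [extra] those of the isolated vertices. *)
Definition balanced (ks : seq nat) (r : nat) : Prop :=
  exists ls extra, [/\ map size ls = ks, size extra = r,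
    fair (flatten ls ++ extra) & fair (map total ls)].

Lemma balanced_perm (ks ks' : seq nat) (r : nat) :
  perm_eq ks' ks -> balanced ks r -> balanced ks' r.
Proof.
move=> + [ls [extra [kse <- f1 f2]]]; rewrite -{}kse => /(perm_iotaP 0)[is_].
rewrite size_map => pis ->.
have pls : perm_eq ls (map (nth [::] ls) is_).
  by rewrite perm_sym; apply/(perm_iotaP [::]); exists is_.
exists (map (nth [::] ls) is_), extra; split => //.
- rewrite -map_comp; apply/eq_in_map => i; rewrite (perm_mem pis) mem_iota => /= hi.
  by rewrite (nth_map [::]).
- by apply: fair_perm f1; rewrite perm_cat2r; apply: perm_flatten.
- by apply: fair_perm f2; apply: perm_map.
Qed.

Lemma balanced_grow (k : nat) (ks : seq nat) (r : nat) :
  balanced (k :: ks) r -> balanced (4 + k :: ks) r.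
Proof.
move=> [[|l ls] [extra [//= [<- <-] <- f1 f2]]].
exists ((labels ++ l) :: ls), extra; split => //.
  by rewrite -[flatten _]/((labels ++ l) ++ flatten ls) -!catA (catA l);
    apply: (fair_copies_cat 1).
by rewrite map_cons total_cat (_ : total labels = 0%R) ?add0r //; apply/eqP.
Qed.

Lemma balanced_extra (ks : seq nat) (r r' : nat) :
  r <= r' -> balanced ks r -> balanced ks r'.
Proof.
move=> /subnK <-; elim: (r' - r) => //= d IH /IH [ls [extra [h1 h2 f1 f2]]].
pose n a := count_mem a (flatten ls ++ extra).
case: (@arg_minnP A 0%R xpredT n) => // m _ hm.
exists ls, (m :: extra); split => //=; first by rewrite h2.
have perm : perm_eq (m :: flatten ls ++ extra) (flatten ls ++ m :: extra).
  by rewrite -[m :: extra]cat1s perm_sym perm_catCA.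
apply: (fair_perm perm) => a b; rewrite /= -!/(n _).
move: (hm a isT) (hm b isT) (f1 a b : close (n a) (n b)).
by do 2![case: eqP => [<-|_]] => ? ? [? ?]; split; lia.
Qed.

(** * Backtracking search and its soundness *)

(** An edge sum ignores the order of the labels, so the search tries one sorted representative of
    each multiset. *)
Fixpoint multisets (s : seq A) (k : nat) : seq (seq A) :=
  if s is x :: s' then
    flatten [seq map (cat (nseq (k - i) x)) (multisets s' i) | i <- iota 0 k.+1]
  else nseq (k == 0) [::].

Fixpoint sublists (s : seq A) : seq (seq A) :=
  if s is x :: s' then map (cons x) (sublists s') ++ sublists s' else [:: [::]].

Fixpoint remove (l s : seq A) : option (seq A) :=
  if l is x :: l' then if x \in s then remove l' (rem x s) else None else Some s.

(* Unlike [has], whose disjunction is evaluated strictly by [vm_compute], [find]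
   stops at the first success. *)
Definition lazy_has {T : Type} (p : pred T) (s : seq T) : bool := find p s < size s.

(** [vs] holds the vertex labels still available, [es] the edge sums still to be attained; labels
    left at the end go to isolated vertices. *)
Fixpoint search (ks : seq nat) (vs es : seq A) : bool :=
  if ks is k :: ks' then
    lazy_has (fun l =>
      if size l != k then false else
      if total l \notin es then false else
      if remove l vs is Some vs' then search ks' vs' (rem (total l) es) else false)
    (multisets labels k)
  else nilp es.

(** Up to order, a fair sequence is some copies of all four labels followed by fewer than four
    distinct ones. *)
Definition budgets (n : nat) : seq (seq A) :=
  [seq flatten (nseq (n %/ 4) labels) ++ s | s <- sublists labels & size s == n %% 4].

(* Without isolated vertices the totals of labels and of edge sums must agree;
   testing this first spares the search its hopeless budgets. *)
Definition solvable (ks : seq nat) (r : nat) : bool :=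
  lazy_has (fun vs => lazy_has (fun es =>
      if (r == 0) && (total vs != total es) then false else search ks vs es)
    (budgets (size ks))) (budgets (sumn ks + r)).

Lemma lazy_hasP {T : eqType} (p : pred T) (s : seq T) :
  reflect (exists2 x, x \in s & p x) (lazy_has p s).
Proof. by rewrite /lazy_has -has_find; apply: hasP. Qed.

Lemma remove_perm (l s s' : seq A) : remove l s = Some s' -> perm_eq s (l ++ s').
Proof.
elim: l s => [|x l IH] s /=; first by case=> ->.
case: ifP => // xs /IH p; apply: perm_trans (perm_to_rem xs) _.
by rewrite perm_cons.
Qed.

Lemma search_sound (ks : seq nat) (vs es : seq A) : search ks vs es ->
  exists ls extra, [/\ map size ls = ks, perm_eq vs (flatten ls ++ extra)
    & perm_eq es (map total ls)].
Proof.
elim: ks vs es => [|k ks IH] vs es /=; first by move/nilP->; exists [::], vs.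
case/lazy_hasP => l _; case: eqP => //= sl; case: ifP => // /negbFE tl.
case rl: remove => [vs'|] // /IH [ls [extra [<- p1 p2]]].
exists (l :: ls), extra; split; rewrite /= ?sl //.
  by rewrite -catA; apply: perm_trans (remove_perm _ _ _ rl) _; rewrite perm_cat2l.
by apply: perm_trans (perm_to_rem tl) _; rewrite perm_cons.
Qed.

Lemma budgets_sound (n : nat) (s : seq A) : s \in budgets n -> fair s /\ size s = n.
Proof.
case/mapP => t; rewrite mem_filter => /andP[/eqP st tin] ->; split.
  apply/fair_copies_cat/fair_uniq; move: t tin {st}; apply/allP; by vm_compute.
rewrite size_cat st size_flatten /shape map_nseq sumn_nseq /=; lia.
Qed.

Lemma solvable_sound (ks : seq nat) (r : nat) : solvable ks r -> balanced ks r.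
Proof.
case/lazy_hasP => vs /budgets_sound[fvs svs] /lazy_hasP[es /budgets_sound[fes _]].
case: ifP => // _ /search_sound[ls [extra [kse p1 p2]]]; rewrite -{}kse in svs *.
exists ls, extra; split => //; [|exact: fair_perm p1 _|exact: fair_perm p2 _].
by move: (perm_size p1); rewrite svs size_cat size_flatten /shape => /addnI.
Qed.

(** * Reduction to the finite base cases *)

Lemma quadruple (k : nat) : 0 < k <= 4 ->
  search (nseq 4 k) (flatten (nseq k labels)) labels.
Proof. by case: k => [|[|[|[|[|k]]]]] // _; vm_compute. Qed.

Lemma balanced_quadruples (q k : nat) (ks : seq nat) (r : nat) : 0 < k <= 4 ->
  balanced ks r -> balanced (nseq (4 * q) k ++ ks) r.
Proof.
move=> hk bks; elim: q => [|q IH]; first by rewrite muln0.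
have [ls [extra [h1 h2 f1 f2]]] := IH.
have [ls' [extra' [h1' h2' f2']]] := search_sound _ _ _ (quadruple k hk).
(* Four edges of size [k] use up all [4 * k] labels. *)
have /nilP extra0 : nilp extra'.
  have := perm_size h2'; rewrite size_cat !size_flatten /shape h1' map_nseq !sumn_nseq /nilp /=.
  lia.
exists (ls' ++ ls), extra; split => //.
- by rewrite map_cat h1 h1' mulnS nseqD catA.
- rewrite flatten_cat -catA; apply: (fair_perm _ (fair_copies_cat k _ f1)).
  by rewrite perm_cat2r; move: h2'; rewrite extra0 cats0.
- rewrite map_cat; apply: (fair_perm _ (fair_copies_cat 1 _ f2)).
  by rewrite perm_cat2r.
Qed.

(** With [n] vertices in [m] edges this is the failure of the condition in (i); coerced to a number,
    it is the number of isolated vertices that suffices. *)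
Definition obstructed (n m : nat) : bool :=
  [&& ~~ odd n, ~~ odd m & n != m %[mod 4]].

Lemma obstructed_add4 (n m p q : nat) :
  obstructed (4 * p + n) (4 * q + m) = obstructed n m.
Proof. by rewrite /obstructed !(mulnC 4) !modnMDl !oddD !oddM !andbF. Qed.

(* The search is fastest when the edges of size 3 come last. *)
Definition small_sizes (c1 c2 c3 c4 : nat) : seq nat :=
  nseq c1 1 ++ nseq c2 2 ++ nseq c4 4 ++ nseq c3 3.

Lemma base_cases (c1 c2 c3 c4 : nat) : c1 < 4 -> c2 < 4 -> c3 < 4 -> c4 < 4 ->
  let ks := small_sizes c1 c2 c3 c4 in
  solvable ks (obstructed (sumn ks) (size ks)).
Proof.
pose four := iota 0 4.
have : all (fun c1 => all (fun c2 => all (fun c3 => all (fun c4 =>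
  let ks := small_sizes c1 c2 c3 c4 in
  solvable ks (obstructed (sumn ks) (size ks))) four) four) four) four.
  by vm_compute.
have inF c : c < 4 -> c \in four by rewrite mem_iota.
move=> /allP h h1 h2 h3 h4.
have /allP g1 := h _ (inF _ h1); have /allP g2 := g1 _ (inF _ h2).
by have /allP g3 := g2 _ (inF _ h3); apply: g3 (inF _ h4).
Qed.

Lemma small_sizes_mod4 (c1 c2 c3 c4 : nat) :
  perm_eq (small_sizes c1 c2 c3 c4)
    (nseq (4 * (c1 %/ 4)) 1 ++ nseq (4 * (c2 %/ 4)) 2 ++
     nseq (4 * (c3 %/ 4)) 3 ++ nseq (4 * (c4 %/ 4)) 4 ++
     small_sizes (c1 %% 4) (c2 %% 4) (c3 %% 4) (c4 %% 4)).
Proof.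
apply/permP => a; rewrite /small_sizes !count_cat !count_nseq.
(* A predicate enters only through its values at 1, 2, 3 and 4. *)
by case: (a 1) (a 2) (a 3) (a 4) => [] [] [] []; lia.
Qed.

Lemma small_sizes_perm (ks : seq nat) : all (fun k => 0 < k <= 4) ks ->
  exists c1 c2 c3 c4, perm_eq ks (small_sizes c1 c2 c3 c4).
Proof.
elim: ks => [_|k ks IH]; first by exists 0, 0, 0, 0.
rewrite [all _ _]/= => /andP[hk /IH[c1 [c2 [c3 [c4 p]]]]].
exists ((k == 1) + c1), ((k == 2) + c2), ((k == 3) + c3), ((k == 4) + c4).
apply/permP => a; move/permP: p => /(_ a).
rewrite /= /small_sizes !count_cat !count_nseq => ->.
by case: k hk => [|[|[|[|[|k]]]]] //= _; lia.
Qed.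

Lemma balanced_of_small (ks : seq nat) (r : nat) : all (fun k => 0 < k <= 4) ks ->
  obstructed (sumn ks) (size ks) <= r -> balanced ks r.
Proof.
move=> /small_sizes_perm[c1 [c2 [c3 [c4 p]]]].
have {}p := perm_trans p (small_sizes_mod4 c1 c2 c3 c4).
have lt4 c : c %% 4 < 4 by rewrite ltn_mod.
have base := base_cases _ _ _ _ (lt4 c1) (lt4 c2) (lt4 c3) (lt4 c4).
move: (small_sizes _ _ _ _) p base => ks0 p base.
have -> : sumn ks =
    4 * (c1 %/ 4 + 2 * (c2 %/ 4) + 3 * (c3 %/ 4) + 4 * (c4 %/ 4)) + sumn ks0.
  by rewrite (perm_sumn p) !sumn_cat !sumn_nseq; lia.
have -> : size ks = 4 * (c1 %/ 4 + c2 %/ 4 + c3 %/ 4 + c4 %/ 4) + size ks0.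
  by rewrite (perm_size p) !size_cat !size_nseq !mulnDr !addnA.
rewrite obstructed_add4 => le_r.
apply: balanced_perm p _; do 4![apply: balanced_quadruples => //].
exact: balanced_extra le_r (solvable_sound _ _ base).
Qed.

Lemma balanced_of_positive (ks : seq nat) (r : nat) : all (fun k => 0 < k) ks ->
  obstructed (sumn ks) (size ks) <= r -> balanced ks r.
Proof.
have [n] := ubnP (sumn ks); elim: n ks => // n IH ks hn pos ob.
have [/hasP[k kin k4]|/hasPn small] := boolP (has (fun k => 4 < k) ks); last first.
  apply: balanced_of_small ob; apply/allP => k kin.
  by rewrite (allP pos) //= leqNgt small.
have [rest p] : exists rest, perm_eq ks (k :: rest).
  by exists (rem k ks); apply: perm_to_rem.
apply: (balanced_perm _ _ _ p).
rewrite (perm_sumn p) /= in hn; rewrite (perm_all _ p) /= in pos.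
rewrite (perm_sumn p) (perm_size p) /= in ob.
(* The size is split as [4 + (k - 4)]; strictness of [4 < k] keeps the shortened edge non-empty. *)
rewrite -(subnKC (ltnW k4)) in hn ob *.
apply/balanced_grow/IH => /=; first by lia.
  by case/andP: pos => _ ->; rewrite andbT subn_gt0.
by rewrite -addnA (obstructed_add4 _ _ 1 0) in ob.
Qed.

(** * From hypergraphs to edge sizes *)

Definition isolated {V : finType} (E : {set {set V}}) : {set V} :=
  [set v | degree E v == 0].

(** This order matches [flatten ls ++ extra], so that labels can be assigned by position. *)
Definition vertex_list {V : finType} (E : {set {set V}}) : seq V :=
  flatten [seq enum e | e : {set V} <- enum E] ++ enum (isolated E).

(** A vertex occurs in the edge blocks as often as its degree, and once more at the end exactly when
    its degree is 0. *)
Lemma vertex_list_perm (V : finType) (E : {set {set V}}) :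
  (forall v, degree E v <= 1) -> perm_eq (vertex_list E) (enum V).
Proof.
move=> deg1; apply/allP => v _ /=; apply/eqP.
rewrite (count_uniq_mem _ (enum_uniq V)) mem_enum inE count_cat count_flatten -map_comp.
rewrite sumnE big_map big_enum /= (count_uniq_mem _ (enum_uniq _)) mem_enum inE.
rewrite (_ : \sum_(e in E) _ = degree E v); first by have := deg1 v; lia.
rewrite /degree -sum1_card big_mkcond [RHS]big_mkcond /=; apply: eq_bigr => e _.
by rewrite inE (count_uniq_mem _ (enum_uniq _)) mem_enum; case: (e \in E); case: (v \in e).
Qed.

Lemma vcountE (V : finType) (c : V -> A) (a : A) (s : seq V) :
  perm_eq s (enum V) -> vcount c a = count_mem a (map c s).
Proof.
move=> /(perm_map c)/permP ->.
rewrite -sum1_count big_map big_enum_cond /vcount -sum1_card.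
by apply: eq_bigl => v; rewrite !inE.
Qed.

Lemma ecountE (V : finType) (E : {set {set V}}) (c : V -> A) (a : A) :
  ecount E c a = count_mem a [seq induced c e | e <- enum E].
Proof.
rewrite -sum1_count big_map big_enum_cond /ecount -sum1_card.
by apply: eq_bigl => e; rewrite !inE.
Qed.

Lemma cordial_of_balanced (V : finType) (E : {set {set V}}) :
  (forall v, degree E v <= 1) ->
  balanced [seq #|e| | e : {set V} <- enum E] #|isolated E| -> cordial E.
Proof.
move=> deg1 [ls [extra [szls szx fv fe]]].
have vp := vertex_list_perm V E deg1.
have uv : uniq (vertex_list E) by rewrite (perm_uniq vp) enum_uniq.
have sz_blocks : shape [seq enum e | e : {set V} <- enum E] = shape ls.
  by rewrite [RHS]szls /shape -map_comp; apply: eq_map => e /=; rewrite -cardE.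
have sz : size (vertex_list E) = size (flatten ls ++ extra).
  by rewrite !size_cat !size_flatten sz_blocks szx cardE.
(* The default 0 is never reached, since every index is in range by [vp] and [sz]. *)
pose c v := nth (0 : A)%R (flatten ls ++ extra) (index v (vertex_list E)).
have cE : map c (vertex_list E) = flatten ls ++ extra.
  apply: (@eq_from_nth _ (0 : A)%R) => [|i]; rewrite size_map // => hi.
  have [v0 _] : exists v0 : V, true.
    by case: (vertex_list E) hi => // v0; exists v0.
  by rewrite (nth_map v0) // /c index_uniq.
(* Equal flattenings cut into blocks of the same lengths have equal blocks, so each edge receives
   its own list from [ls]. *)
have blocks : [seq map c (enum e) | e : {set V} <- enum E] = ls.
  rewrite (map_comp (map c)); apply: eq_from_flatten_shape.
    rewrite -map_flatten; move/eqP: cE; rewrite map_cat eqseq_cat; first by case/andP => /eqP.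
    by rewrite size_map !size_flatten sz_blocks.
  rewrite -sz_blocks /shape -[in LHS]map_comp; apply: eq_map => s /=; exact: size_map.
exists c; split => a b; last first.
  rewrite !ecountE (_ : map _ _ = map total ls) //.
  rewrite -blocks -map_comp; apply: eq_map => e /=.
  by rewrite totalE big_map big_enum.
by rewrite !(vcountE V c _ _ vp) cE.
Qed.

Lemma card_vertices (V : finType) (E : {set {set V}}) :
  (forall v, degree E v <= 1) ->
  #|V| = sumn [seq #|e| | e : {set V} <- enum E] + #|isolated E|.
Proof.
move=> deg1; rewrite (cardE V) -(perm_size (vertex_list_perm V E deg1)).
rewrite size_cat size_flatten /shape -map_comp -cardE; congr (sumn _ + _).
by apply: eq_map => e /=; rewrite -cardE.
Qed.

(** * Necessity and conclusion *)

Lemma cordial_not_obstructed (V : finType) (E : {set {set V}}) :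
  (forall v, degree E v = 1) -> cordial E -> ~~ obstructed #|V| #|E|.
Proof.
move=> deg1 [c [fv fe]]; apply/negP => /and3P[evV evE].
have iso0 : isolated E = set0 by apply/setP => v; rewrite !inE deg1.
have vp : perm_eq (vertex_list E) (enum V).
  by apply: vertex_list_perm => v; rewrite deg1.
have fV : fair (map c (vertex_list E)) by move=> a b; rewrite -!vcountE.
have fE : fair [seq induced c e | e <- enum E] by move=> a b; rewrite -!ecountE.
have szV : size (map c (vertex_list E)) = #|V| by rewrite size_map (perm_size vp) -cardE.
have szE : size [seq induced c e | e <- enum E] = #|E| by rewrite size_map -cardE.
have := sum_fair_eq0 _ fV; have := sum_fair_eq0 _ fE; rewrite szV szE => /(_ evE) + /(_ evV).
have -> : (\sum_(x <- map c (vertex_list E)) x = \sum_(x <- [seq induced c e | e <- enum E]) x)%R.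
  rewrite !big_map /vertex_list iso0 enum_set0 cats0 big_flatten big_map.
  by apply: eq_bigr => e _; rewrite big_enum.
(* Two even numbers that agree on divisibility by 4 are congruent mod 4. *)
move=> -> ; lia.
Qed.

Theorem theorem6 (V : finType) (E : {set {set V}})
    (Hne : forall e, e \in E -> e != set0)
    (Hdeg : forall v : V, (degree E v <= 1)%N) :
  ((forall v : V, degree E v = 1%N) ->
     (cordial E <->
        (odd #|V| \/ odd #|E| \/
         (~~ odd #|V| /\ ~~ odd #|E| /\ #|V| = #|E| %[mod 4]))))
  /\
  ((exists v : V, degree E v = 0%N) -> cordial E).
Proof.
have sizes_pos : all (fun k => 0 < k) [seq #|e| | e : {set V} <- enum E].
  by apply/allP => _ /mapP[e + ->]; rewrite mem_enum card_gt0 => /Hne.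
have cordialE : obstructed (sumn [seq #|e| | e : {set V} <- enum E]) #|E| <= #|isolated E| ->
    cordial E.
  move=> ob; apply: (cordial_of_balanced _ _ Hdeg); apply: (balanced_of_positive _ _ sizes_pos).
  by rewrite size_map -cardE.
have VE := card_vertices V E Hdeg.
split=> [deg1|[v v0]]; last first.
  (* The obstruction counts for at most 1, and [v] is isolated. *)
  by apply: cordialE; apply: leq_trans (leq_b1 _) _; apply/card_gt0P; exists v; rewrite inE v0.
split=> [/(cordial_not_obstructed V E deg1)|cond].
  rewrite /obstructed; case: (odd #|V|); first by left.
  case: (odd #|E|); first by right; left.
  by rewrite negbK => /eqP eqVE; right; right.
have iso0 : #|isolated E| = 0.
  by apply/eqP; rewrite cards_eq0; apply/eqP/setP => v; rewrite !inE deg1.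
(* Adding the zero count of isolated vertices turns the sum of the edge sizes into the number of
   vertices. *)
apply: cordialE; rewrite iso0 -(addn0 (sumn _)) -{1}iso0 -VE leqn0 eqb0.
by rewrite /obstructed; case: cond => [->//|[->|[_ [_ ->]]]]; rewrite ?eqxx ?andbF.
Qed.
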